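(* Let $H=H_n$, let $\mathfrak{h}=\mathfrak{p}\oplus\mathbb{R}Z_0$ be a splitting with $0\neq Z_0\in\mathfrak{z}$, and let $\Phi:\mathbb{R}\to\mathrm{Aut}(H)$ be a path that is metric-defining with respect to $\mathfrak{p}$ and $Z_0$. Then the Lorentz metric on $\mathbb{R}*_\Phi H$ associated to $\Phi$ and $Z_0$ is $H$-invariant.
   Context: $H=H_n$ ($n\ge 1$) is the simply connected Lie group with Lie algebra $\mathfrak{h}$ having basis $X_1,\dots,X_n,Y_1,\dots,Y_n,Z$ with only nonzero brackets $[X_i,Y_i]=Z=-[Y_i,X_i]$; $\mathfrak{z}=\mathbb{R}Z$ is its center. Elements of $\mathfrak{h}$ are regarded as right-invariant vector fields on $H$, with the corresponding bracket, so that for a left action of $H$ the map $X\mapsto X^*$ to the induced vector fields is a Lie algebra homomorphism; $e^{tX}$ is the one-parameter subgroup with velocity $X$ at the identity. Let $\omega_0$ be the symplectic form on $\mathfrak{p}$ with $[X,Y]=\omega_0(X,Y)Z_0$. An endomorphism $\nu$ of $\mathfrak{p}$ is infinitesimally definite if $\omega_0(X,\nu(X))>0$ for all $0\neq X\in\mathfrak{p}$. Let $\mathcal{M}_{\mathfrak{p}}$ be the set of derivations $\delta$ of $\mathfrak{h}$ preserving $\mathfrak{p}$ with $\delta(Z_0)=0$ and $\delta|_{\mathfrak{p}}$ infinitesimally definite. A (smooth) path $\Phi:\mathbb{R}\to\mathrm{Aut}(H)$, with $\varphi_t=D_e\Phi_t$, is metric-defining with respect to $\mathfrak{p}$ and $Z_0$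 if $\varphi_t^{-1}\circ\left(\frac{\partial\varphi_s}{\partial s}\right)_{s=t}\in\mathcal{M}_{\mathfrak{p}}$ for all $t$; $\nu_t$ denotes the restriction of this derivation to $\mathfrak{p}$ (it is invertible). $\mathbb{R}*_\Phi H$ is the manifold $\mathbb{R}\times H$ with $H$-action $h.(t,g)=(t,\Phi_t(h)g)$. Let $W=\partial/\partial t$ and $f_x(Y)=\frac{d}{dr}\big|_{r=0}(e^{rY}.x)$ for $Y\in\mathfrak{h}$. The associated Lorentz metric is defined at each $x$, with $\mathbb{R}$-coordinate $t(x)$, by: $\langle W,W\rangle=0$, $\langle W,f_x(Z_0)\rangle=1$, $W\perp f_x(\mathfrak{p})$, $\langle f_x(Z_0),f_x(Z_0)\rangle=0$, $f_x(Z_0)\perp f_x(\mathfrak{p})$, and $\langle f_x(X),f_x(Y)\rangle=\omega_0(\nu_{t(x)}^{-1}(X),Y)$ for $X,Y\in\mathfrak{p}$. *)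

(* Defs.v *)
From HB Require Import structures.
From mathcomp Require Import all_boot all_order all_algebra ring lra.
From mathcomp Require Import all_classical all_reals topology normedtype derive.

Set Implicit Arguments.
Unset Strict Implicit.
Unset Printing Implicit Defensive.

Import Order.TTheory GRing.Theory Num.Theory.
Import numFieldNormedType.Exports.

Local Open Scope classical_set_scope.
Local Open Scope ring_scope.

(* The basis is X_i = (e_i, 0, 0), Y_i = (0, e_i, 0), Z = (0, 0, 1). *)
Notation heis_alg R n := ('rV[R]_n * 'rV[R]_n * R)%type.

(* H_n in exponential coordinates: its carrier, and each of its tangent spaces,
   is that of h. *)
Notation heis R n := ('rV[R]_n * 'rV[R]_n * R)%type (only parsing).

(* The manifold R x H, also standing for each of its tangent spaces. *)
Notation spacetime R n := (R * heis R n)%type.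

Lemma derive1_line {R : realType} {V W : normedModType R} (f : V -> W) v :
  derive1 (fun r : R => f (r *: v)) 0 = 'D_v f 0.
Proof.
rewrite derive1E /derive scale0r.
suff -> : (fun h : R => h^-1 *:
    (((fun r : R => f (r *: v)) \o shift 0) h%:A - f 0)) =
    fun h : R => h^-1 *: ((f \o shift 0) (h *: v) - f 0) by [].
by apply/funext => h /=; rewrite !addr0 [h *: (1 : R)]mulr1.
Qed.

Section Heisenberg.
Context {R : realType} {n : nat}.
Implicit Types (X Y Z : heis_alg R n) (g h : heis R n).

Definition heis_bracket X Y : heis_alg R n :=
  (0, 0, \sum_(i < n) (X.1.1 0 i * Y.1.2 0 i - X.1.2 0 i * Y.1.1 0 i)).

(* Elements of h are right-invariant vector fields, and their bracket is the
   opposite of the left-invariant one: hence the minus sign in the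
   Baker-Campbell-Hausdorff formula. See right_inv_field_bracket. *)
Definition heis_mul g h : heis R n := g + h - 2^-1 *: heis_bracket g h.

(* See heis_expD and heis_exp_velocity. *)
Definition heis_exp X : heis R n := X.

Definition central Z := forall X, heis_bracket Z X = 0.

Definition derivation (d : 'End(heis_alg R n)) :=
  forall X Y,
    d (heis_bracket X Y) = heis_bracket (d X) Y + heis_bracket X (d Y).

(* As Z0 spans the center R Z, the form such that [X, Y] = omega0(X, Y) Z0 is
   the quotient of the Z-coordinates. See omega0P. *)
Definition omega0 (Z0 : heis_alg R n) X Y : R := (heis_bracket X Y).2 / Z0.2.

Lemma heis_bracket_basis (i j : 'I_n) :
  [/\ heis_bracket (delta_mx 0 i, 0, 0) (0, delta_mx 0 j, 0)
        = (0, 0, (i == j)%:R),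
      heis_bracket (delta_mx 0 i, 0, 0) (delta_mx 0 j, 0, 0) = 0,
      heis_bracket (0, delta_mx 0 i, 0) (0, delta_mx 0 j, 0) = 0
    & forall X, heis_bracket (0, 0, 1) X = 0].
Proof.
rewrite /heis_bracket /=; split => [|||X].
- congr (_, _, _); rewrite (bigD1 i) //= big1 => [|k /negPf ki].
    by rewrite !mxE !eqxx /= mul1r mul0r subr0 addr0.
  by rewrite !mxE ki andbF !mul0r subr0.
- by rewrite big1 // => k _; rewrite !mxE mulr0 mul0r subr0.
- by rewrite big1 // => k _; rewrite !mxE mulr0 mul0r subr0.
- by rewrite big1 // => k _; rewrite !mxE !mul0r subr0.
Qed.

Lemma heis_bracketC X Y : heis_bracket X Y = - heis_bracket Y X.
Proof.
rewrite /heis_bracket; congr (_, _, _); rewrite ?oppr0 //= -sumrN.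
by apply: eq_bigr => i _; rewrite opprB mulrC addrC [X.1.2 0 i * _]mulrC addrC.
Qed.

Lemma heis_bracket_is_linear Y : linear (heis_bracket ^~ Y).
Proof.
move=> a X X'; rewrite /heis_bracket; congr (_, _, _);
  rewrite /= ?scaler0 ?addr0 //.
rewrite scaler_sumr -big_split /=; apply: eq_bigr => i _.
rewrite !mxE !mulrDl opprD -!mulrA -[_ *: _]/(_ * _) mulrBr addrACA.
done.
Qed.

Definition heis_bracketl Y X := heis_bracket X Y.

HB.instance Definition _ Y := GRing.isLinear.Build R (heis_alg R n)
  (heis_alg R n) _ (heis_bracketl Y) (heis_bracket_is_linear Y).

Lemma heis_bracketDl X X' Y :
  heis_bracket (X + X') Y = heis_bracket X Y + heis_bracket X' Y.
Proof. exact: (linearD (heis_bracketl Y)). Qed.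

Lemma heis_bracketZl a X Y : heis_bracket (a *: X) Y = a *: heis_bracket X Y.
Proof. exact: (linearZ_LR (heis_bracketl Y)). Qed.

Lemma heis_bracketDr X Y Y' :
  heis_bracket X (Y + Y') = heis_bracket X Y + heis_bracket X Y'.
Proof. by rewrite 3!(heis_bracketC X) heis_bracketDl opprD. Qed.

Lemma heis_bracketZr a X Y : heis_bracket X (a *: Y) = a *: heis_bracket X Y.
Proof. by rewrite 2!(heis_bracketC X) heis_bracketZl scalerN. Qed.

Lemma heis_bracketNl X Y : heis_bracket (- X) Y = - heis_bracket X Y.
Proof. exact: (linearN (heis_bracketl Y)). Qed.

Lemma heis_bracket0l Y : heis_bracket 0 Y = 0.
Proof. exact: (linear0 (heis_bracketl Y)). Qed.

Lemma heis_bracketXX X : heis_bracket X X = 0.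
Proof.
rewrite /heis_bracket big1 // => i _.
by rewrite [X.1.2 0 i * _]mulrC subrr.
Qed.

Lemma heis_bracket_bracketl X Y Z : heis_bracket (heis_bracket X Y) Z = 0.
Proof.
by rewrite {1}/heis_bracket big1 // => i _; rewrite /= !mxE !mul0r subrr.
Qed.

Lemma heis_bracket_bracketr X Y Z : heis_bracket X (heis_bracket Y Z) = 0.
Proof. by rewrite heis_bracketC heis_bracket_bracketl oppr0. Qed.

Lemma continuous_heis_bracketl Y : continuous (heis_bracketl Y).
Proof.
move=> X.
pose s X := \sum_(i < n) (X.1.1 0 i * Y.1.2 0 i - X.1.2 0 i * Y.1.1 0 i).
have -> : heis_bracketl Y = fun X => s X *: (0, 0, 1).
  apply/funext => X'; rewrite /heis_bracketl /heis_bracket.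
  by congr (_, _, _); rewrite /= ?scaler0 // -[_ *: _]/(_ * _) mulr1.
apply: cvgZr_tmp.
have c11 i : {for X, continuous (fun X : heis_alg R n => X.1.1 0 i)}.
  apply: (@continuous_comp _ _ _ (fun X : heis_alg R n => X.1.1)
    (fun A : 'rV_n => A 0 i)); last exact: coord_continuous.
  apply: (@continuous_comp (heis_alg R n) ('rV[R]_n * 'rV[R]_n)%type 'rV[R]_n fst fst).
   exact: cvg_fst. exact: cvg_fst.
have c12 i : {for X, continuous (fun X : heis_alg R n => X.1.2 0 i)}.
  apply: (@continuous_comp _ _ _ (fun X : heis_alg R n => X.1.2)
    (fun A : 'rV_n => A 0 i)); last exact: coord_continuous.
  by apply: (@continuous_comp (heis_alg R n) ('rV[R]_n * 'rV[R]_n)%type 'rV[R]_n fst snd);[exact: cvg_fst|exact: cvg_snd].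
apply: (@cvg_big _ _ +%R) => [|i _]; first exact: add_continuous.
by apply: cvgB; apply: cvgMr_tmp; [exact: c11|exact: c12].
Qed.

Lemma heis_mulA : associative heis_mul.
Proof.
move=> f g h; rewrite /heis_mul !(heis_bracketDl, heis_bracketDr).
rewrite -!scaleNr !(heis_bracketZl, heis_bracketZr) heis_bracket_bracketl.
rewrite heis_bracket_bracketr !scaler0 !addr0 !scalerDr -!addrA.
congr (_ + (_ + _)); rewrite [RHS]addrCA; congr (_ + _).
by rewrite [LHS]addrC -addrA.
Qed.

Lemma heis_mul0l : left_id 0 heis_mul.
Proof. by move=> g; rewrite /heis_mul heis_bracket0l scaler0 subr0 add0r. Qed.

Lemma heis_mulNl : left_inverse 0 -%R heis_mul.
Proof.
move=> g; rewrite /heis_mul heis_bracketNl heis_bracketXX.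
by rewrite oppr0 scaler0 subr0 addNr.
Qed.

Lemma heis_expD X (s t : R) :
  heis_exp ((s + t) *: X) = heis_mul (heis_exp (s *: X)) (heis_exp (t *: X)).
Proof.
rewrite /heis_mul /heis_exp heis_bracketZl heis_bracketZr heis_bracketXX.
by rewrite !scaler0 subr0 scalerDl.
Qed.

Definition heis_dmulr g X := X - 2^-1 *: heis_bracket X g.

Lemma heis_dmulr_is_linear g : linear (heis_dmulr g).
Proof.
move=> a X Y; rewrite /heis_dmulr heis_bracketDl heis_bracketZl !scalerDr.
by rewrite opprD addrACA scalerN !scalerA [2^-1 * a]mulrC.
Qed.

HB.instance Definition _ g := GRing.isLinear.Build R (heis_alg R n)
  (heis_alg R n) _ (heis_dmulr g) (heis_dmulr_is_linear g).

Lemma continuous_heis_dmulr g : continuous (heis_dmulr g).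
Proof.
move=> X; apply: cvgB; first exact: cvg_id.
by apply: cvgZl_tmp; exact: continuous_heis_bracketl.
Qed.

Lemma heis_dmulr_inj g : injective (heis_dmulr g).
Proof.
suff K : forall X, heis_dmulr g X = 0 -> X = 0.
  by move=> X Y /eqP; rewrite -subr_eq0 -linearB => /eqP/K/subr0_eq.
move=> X; rewrite /heis_dmulr => /subr0_eq XE.
by rewrite XE XE heis_bracketZl heis_bracket_bracketl !scaler0.
Qed.

Lemma is_diff_heis_mulr g h : is_diff h (heis_mul ^~ g) (heis_dmulr g).
Proof.
have -> : heis_mul ^~ g = heis_dmulr g + cst g.
  by apply/funext => X; rewrite /heis_mul /heis_dmulr addrAC.
have cg := @continuous_heis_dmulr g.
have dg : is_diff h (heis_dmulr g) (heis_dmulr g).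
  by apply: DiffDef; [exact: linear_differentiable|exact: diff_lin].
by rewrite -[X in is_diff _ _ X]addr0; exact: is_diffD.
Qed.

Definition right_inv_field X g : heis_alg R n :=
  derive1 (fun r : R => heis_mul (heis_exp (r *: X)) g) 0.

Lemma right_inv_fieldE X g : right_inv_field X g = X - 2^-1 *: heis_bracket X g.
Proof.
have [D1 D2] := is_diff_heis_mulr g 0.
transitivity ('D_X (heis_mul ^~ g) 0); last by rewrite deriveE // D2.
by rewrite -derive1_line.
Qed.

Lemma heis_exp_velocity X :
  derive1 (fun r : R => heis_exp (r *: X)) 0 = X.
Proof.
transitivity (right_inv_field X 0); last first.
  by rewrite right_inv_fieldE heis_bracketC heis_bracket0l oppr0 scaler0 subr0.
congr (derive1 _ 0); apply/funext => r.
by rewrite /heis_mul heis_bracketC heis_bracket0l oppr0 scaler0 subr0 addr0.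
Qed.

Lemma right_inv_field_bracket X Y g :
  'D_(right_inv_field X g) (right_inv_field Y) g
    - 'D_(right_inv_field Y g) (right_inv_field X) g
  = right_inv_field (heis_bracket X Y) g.
Proof.
have E W : right_inv_field W = cst W + heis_bracketl (2^-1 *: W).
  apply/funext => h; rewrite right_inv_fieldE heis_bracketC scalerN opprK.
  by rewrite -heis_bracketZr.
have L (W V : heis_alg R n) :
    'D_V (right_inv_field W) g = 2^-1 *: heis_bracket V W.
  have cW := @continuous_heis_bracketl (2^-1 *: W).
  have dW : differentiable (heis_bracketl (2^-1 *: W)) g.
    exact: linear_differentiable.
  rewrite E deriveD; [|exact: derivable_cst|exact: diff_derivable].
  rewrite derive_cst add0r deriveE //.
  rewrite (diff_lin g cW).
  exact: heis_bracketZr.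
have K U V : heis_bracket (U - 2^-1 *: heis_bracket U g) V = heis_bracket U V.
  by rewrite heis_bracketDl heis_bracketNl heis_bracketZl
    heis_bracket_bracketl scaler0 subr0.
rewrite (L Y) (L X) !right_inv_fieldE (K X Y) (K Y X).
rewrite heis_bracket_bracketl scaler0 subr0 (heis_bracketC Y X) scalerN opprK.
by rewrite -scalerDl -[in RHS](scale1r (heis_bracket X Y)) [in RHS](splitr 1) mul1r.
Qed.

End Heisenberg.

(* C^oo: in finite dimension, all iterated directional derivatives exist and
   are differentiable. *)
Definition smooth {R : realType} {V W : normedModType R} (f : V -> W) :=
  forall (vs : seq V) (x : V),
    differentiable (foldr (fun v (u : V -> W) => 'D_v u) f vs) x.

Section Metric.
Context {R : realType} {n : nat}.
Implicit Types (Phi : R -> heis R n -> heis R n) (p : {vspace heis_alg R n}).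
Implicit Types (x : spacetime R n).

Definition lie_automorphism (f : heis R n -> heis R n) :=
  [/\ smooth f, {morph f : g h / heis_mul g h}
    & exists f', [/\ smooth f', cancel f f' & cancel f' f]].

(* In finite dimension, smoothness of t |-> Phi t as a path in the Lie group
   Aut(H) is joint smoothness of (t, h) |-> Phi t h. *)
Definition aut_path Phi :=
  (forall t, lie_automorphism (Phi t)) /\
  smooth (fun x : spacetime R n => Phi x.1 x.2).

(* varphi_t = D_e Phi_t; the identity element e is 0. *)
Definition path_diff Phi (t : R) : 'End(heis_alg R n) :=
  linfun ('d (Phi t) (0 : heis R n)).

(* The derivative at t of the path s |-> varphi_s in End(h). *)
Definition path_diff' Phi (t : R) : 'End(heis_alg R n) :=
  linfun (fun X => derive1 (fun s => path_diff Phi s X) t).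

Definition log_deriv Phi (t : R) : 'End(heis_alg R n) :=
  ((path_diff Phi t)^-1 \o path_diff' Phi t)%VF.

(* The restriction of d to p; vsproj p is the identity on p, so no projection
   is involved when d preserves p. *)
Definition restr p (d : 'End(heis_alg R n)) : 'End(subvs_of p) :=
  linfun (fun X => vsproj p (d (vsval X))).

Definition inf_definite p (Z0 : heis_alg R n) (nu : 'End(subvs_of p)) :=
  forall X : subvs_of p, X != 0 -> 0 < omega0 Z0 (vsval X) (vsval (nu X)).

(* The set M_p. *)
Definition definite_derivation p (Z0 : heis_alg R n) (d : 'End(heis_alg R n)) :=
  [/\ derivation d, (d @: p <= p)%VS, d Z0 = 0 & inf_definite Z0 (restr p d)].

Definition metric_defining p (Z0 : heis_alg R n) Phi :=
  aut_path Phi /\ forall t, definite_derivation p Z0 (log_deriv Phi t).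

Definition twisted_act Phi (h : heis R n) x : spacetime R n :=
  (x.1, heis_mul (Phi x.1 h) x.2).

(* f_x(Y) *)
Definition fund Phi x (Y : heis_alg R n) : spacetime R n :=
  derive1 (fun r : R => twisted_act Phi (heis_exp (r *: Y)) x) 0.

(* W *)
Definition ddt : spacetime R n := (1, 0).

(* These relations determine g, which exists and has Lorentz signature at every
   point: see associated_metric_exists, associated_metric_unique and
   associated_metric_lorentzian. Smoothness of g is not required. *)
Definition associated_metric p (Z0 : heis_alg R n) Phi
    (g : spacetime R n -> {symmetric (spacetime R n)}) :=
  forall x,
  [/\ g x ddt ddt = 0,
      g x ddt (fund Phi x Z0) = 1,
      forall X, X \in p -> g x ddt (fund Phi x X) = 0,
      g x (fund Phi x Z0) (fund Phi x Z0) = 0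
    & (forall X, X \in p -> g x (fund Phi x Z0) (fund Phi x X) = 0) /\
      forall X Y : subvs_of p,
        g x (fund Phi x (vsval X)) (fund Phi x (vsval Y)) =
        omega0 Z0 (vsval (((restr p (log_deriv Phi x.1))^-1)%VF X)) (vsval Y)].

Definition H_invariant Phi (g : spacetime R n -> {symmetric (spacetime R n)}) :=
  forall (h : heis R n) (x u v : spacetime R n),
    g (twisted_act Phi h x)
      ('d (twisted_act Phi h) x u) ('d (twisted_act Phi h) x v) = g x u v.

End Metric.

(* Signature (-, +, ..., +). *)
Definition lorentzian {R : realType} {V : lmodType R} (b : {symmetric V}) :=
  exists2 T : V, b T T < 0 & forall v, b T v = 0 -> v != 0 -> 0 < b v v.

Lemma null_frame_eval {R : realType} {V : lmodType R} (f : {symmetric V})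
    (a b c e : R) (W Z X Y : V) :
  f W W = 0 -> f W Z = 1 -> f Z Z = 0 -> f W X = 0 -> f W Y = 0 ->
  f Z X = 0 -> f Z Y = 0 ->
  f (a *: W + (c *: Z + X)) (b *: W + (e *: Z + Y)) = a * e + b * c + f X Y.
Proof.
have fC u v : f u v = f v u by rewrite [LHS]hermitian_subproof mul1r.
have fD u v w : f w (u + v) = f w u + f w v by exact: linearDr.
have fZ k u w : f w (k *: u) = k * f w u by exact: linearZr_LR.
rewrite !(fD, fZ) ![f (_ + _) _]fC !(fD, fZ).
rewrite (fC Z W) (fC Y W) (fC Y Z) (fC Y X).
by move=> -> -> -> -> -> -> ->; ring.
Qed.

Section AssociatedMetric.
Context {R : realType} {n : nat}.
Variables (p : {vspace heis_alg R n}) (Z0 : heis_alg R n).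
Hypotheses (Z0_neq0 : Z0 != 0) (Z0_central : central Z0).
Hypotheses (p_add_Z0 : (p + <[Z0]>)%VS = fullv).
Hypotheses (p_cap_Z0 : (p :&: <[Z0]>)%VS = 0%VS).
Variable Phi : R -> heis R n -> heis R n.
Hypothesis Phi_md : metric_defining p Z0 Phi.

Let Phi_diff t h : differentiable (Phi t) h.
Proof. by have [[/(_ t)[/(_ [::] h)]]] := Phi_md. Qed.

Let Phi0 t : Phi t 0 = 0.
Proof.
have [[/(_ t)[_ PhiM _]] _ _] := Phi_md.
have := PhiM 0 0; rewrite heis_mul0l /heis_mul heis_bracketXX scaler0 subr0.
by move/eqP; rewrite -subr_eq0 opprD addNKr oppr_eq0 => /eqP.
Qed.

Let path_diffE t X : path_diff Phi t X = 'd (Phi t) (0 : heis R n) X.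
Proof. by rewrite /path_diff lfunE. Qed.

Let path_diff_ker t : lker (path_diff Phi t) == 0%VS.
Proof.
have [[/(_ t)[_ _ [f' [sf' fK _]]]] _ _] := Phi_md.
apply/lker0P => X Y; rewrite !path_diffE.
have df' : differentiable f' (Phi t 0) := sf' [::] _.
have E : 'd f' (Phi t 0) \o 'd (Phi t) (0 : heis R n) = id
    :> (heis_alg R n -> heis_alg R n).
  rewrite -diff_comp //.
  have -> : f' \o Phi t = idfun by apply/funext => h /=; rewrite fK.
  by rewrite diff_lin // => h; exact: cvg_id.
move=> XY; have EX := congr1 (@^~ X) E; have EY := congr1 (@^~ Y) E.
by apply: etrans (esym EX) (etrans _ EY); congr ('d f' _ _).
Qed.

Let fundE x Y :
  fund Phi x Y = (0, heis_dmulr x.2 (path_diff Phi x.1 Y)).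
Proof.
rewrite /fund; pose f h : spacetime R n := (x.1, heis_mul (Phi x.1 h) x.2).
have dm := is_diff_heis_mulr x.2 (Phi x.1 0).
have dF : is_diff (0 : heis R n) (fun h => heis_mul (Phi x.1 h) x.2)
    (heis_dmulr x.2 \o 'd (Phi x.1) (0 : heis R n)).
  have dP : is_diff (0 : heis R n) (Phi x.1) ('d (Phi x.1) (0 : heis R n)).
    exact: differentiableP.
  exact: is_diff_comp.
have [df df'] : is_diff (0 : heis R n) f (fun h => (0, heis_dmulr x.2 ('d (Phi x.1) (0 : heis R n) h))).
  exact: is_diff_pair.
rewrite (derive1_line f) deriveE //. rewrite df' path_diffE.
done.
Qed.

Let Z0E : Z0 = (0, 0, Z0.2).
Proof.
have Z1 i : Z0.1.1 0 i = 0.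
  have := congr1 snd (Z0_central (0, delta_mx 0 i, 0)).
  rewrite /= (bigD1 i) //= big1 => [|j /negPf ji].
    by rewrite !mxE !eqxx mulr1 mulr0 subr0 addr0.
  by rewrite !mxE ji andbF !mulr0 subr0.
have Z2 i : Z0.1.2 0 i = 0.
  have := congr1 snd (Z0_central (delta_mx 0 i, 0, 0)).
  rewrite /= (bigD1 i) //= big1 => [|j /negPf ji].
    by rewrite !mxE !eqxx mulr1 mulr0 sub0r addr0 => /eqP; rewrite oppr_eq0 => /eqP.
  by rewrite !mxE ji andbF !mulr0 subr0.
rewrite [LHS]surjective_pairing [Z0.1]surjective_pairing.
by congr (_, _, _); apply/rowP => i; rewrite mxE.
Qed.

Let Z0_2 : Z0.2 != 0.
Proof. by apply: contraNneq Z0_neq0 => Z3; rewrite Z0E Z3. Qed.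

Lemma omega0P X Y : heis_bracket X Y = omega0 Z0 X Y *: Z0.
Proof.
rewrite /omega0 [in RHS]Z0E; congr (_, _, _); rewrite /= ?scaler0 //.
by rewrite -[RHS]/(_ * _) divfK.
Qed.


Let frame x : 'End(heis_alg R n) :=
  linfun (heis_dmulr x.2 \o path_diff Phi x.1).

Let frameE x Y : frame x Y = heis_dmulr x.2 (path_diff Phi x.1 Y).
Proof. exact: (lfunE (heis_dmulr x.2 \o path_diff Phi x.1)). Qed.

Let fund_frame x Y : fund Phi x Y = (0, frame x Y).
Proof. by rewrite fundE frameE. Qed.

Let frame_ker x : lker (frame x) == 0%VS.
Proof.
apply/lker0P => X Y; rewrite !frameE => /heis_dmulr_inj.
exact: (lker0P (path_diff_ker _)).
Qed.

Let nu t := restr p (log_deriv Phi t).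

Let nuE t (X : subvs_of p) : vsval (nu t X) = log_deriv Phi t (vsval X).
Proof.
have [_ /(_ t)[_ dp _ _]] := Phi_md.
rewrite /nu /restr (lfunE (vsproj p \o (log_deriv Phi t \o vsval))) /= vsprojK //.
by apply: (subvP dp); exact/memv_img/subvsP.
Qed.

Let omega0D X X' Y : omega0 Z0 (X + X') Y = omega0 Z0 X Y + omega0 Z0 X' Y.
Proof. by rewrite /omega0 heis_bracketDl mulrDl. Qed.

Let omega0Z a X Y : omega0 Z0 (a *: X) Y = a * omega0 Z0 X Y.
Proof. by rewrite /omega0 heis_bracketZl mulrA. Qed.

Let omega0C X Y : omega0 Z0 X Y = - omega0 Z0 Y X.
Proof. by rewrite /omega0 heis_bracketC mulNr. Qed.

Let nu_ker t : lker (nu t) == 0%VS.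
Proof.
have [_ /(_ t)[_ _ _ dX]] := Phi_md.
rewrite -subv0; apply/subvP => X; rewrite memv_ker memv0 => /eqP nuX.
apply: contraT => /dX; rewrite -/(nu t) nuX linear0.
by rewrite /omega0 heis_bracketC heis_bracket0l oppr0 mul0r ltxx.
Qed.

Let nu_sym t (X Y : subvs_of p) :
  omega0 Z0 (vsval X) (vsval (nu t Y)) = omega0 Z0 (vsval Y) (vsval (nu t X)).
Proof.
have [_ /(_ t)[dM _ dZ0 _]] := Phi_md.
have := dM (vsval X) (vsval Y); rewrite !omega0P linearZ /= dZ0 scaler0.
rewrite -scalerDl => /esym/eqP; rewrite scaler_eq0 (negPf Z0_neq0) orbF.
by rewrite -!nuE [omega0 _ _ (vsval Y)]omega0C addrC subr_eq0 => /eqP.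
Qed.

Let ppart x : 'Hom(heis_alg R n, subvs_of p) :=
  linfun (vsproj p \o (daddv_pi p <[Z0]> \o (frame x)^-1%VF)).

Let zpart x (v : heis_alg R n) : R :=
  (daddv_pi <[Z0]> p ((frame x)^-1%VF v)).2 / Z0.2.

Let zpartP x a v w : zpart x (a *: v + w) = a * zpart x v + zpart x w.
Proof. by rewrite /zpart !linearP /= mulrDl -mulrA. Qed.

Let zpart_frame x (c : R) X : X \in p -> zpart x (frame x (X + c *: Z0)) = c.
Proof.
move=> Xp; rewrite /zpart lker0_lfunK // linearD /= linearZ /=.
rewrite [daddv_pi _ _ Z0]daddv_pi_id ?memv_line //; last by rewrite capvC.
have -> : daddv_pi <[Z0]> p X = 0.
  have := daddv_pi_add p_cap_Z0 (_ : X \in (p + <[Z0]>)%VS).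
  rewrite p_add_Z0 memvf daddv_pi_id // => /(_ isT) /eqP.
  by rewrite addrC -subr_eq0 addrK => /eqP.
by rewrite add0r; exact: mulfK.
Qed.

Let ppart_frame x (c : R) (X : subvs_of p) :
  ppart x (frame x (vsval X + c *: Z0)) = X.
Proof.
rewrite /ppart lfunE /= lker0_lfunK // linearD /= daddv_pi_id ?subvsP //.
have -> : daddv_pi p <[Z0]> (c *: Z0) = 0.
  have := daddv_pi_add (_ : <[Z0]> :&: p = 0)%VS (_ : c *: Z0 \in (<[Z0]> + p)%VS).
  rewrite capvC addvC p_add_Z0 memvf daddv_pi_id ?memvZ ?memv_line //; last by rewrite capvC.
  by move=> /(_ p_cap_Z0 isT) /eqP; rewrite addrC -subr_eq0 addrK => /eqP.
by rewrite addr0 vsvalK.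
Qed.

Let decomp x v : exists X : subvs_of p, exists c, v = frame x (vsval X + c *: Z0).
Proof.
have : (frame x)^-1%VF v \in (p + <[Z0]>)%VS by rewrite p_add_Z0 memvf.
case/memv_addP => X Xp [_ /vlineP[c ->] E].
exists (vsproj p X), c; rewrite vsprojK // -E.
by rewrite lker0_lfunVK.
Qed.

Let metric x (u v : spacetime R n) : R :=
  u.1 * zpart x v.2 + v.1 * zpart x u.2 +
  omega0 Z0 (vsval ((nu x.1)^-1%VF (ppart x u.2))) (vsval (ppart x v.2)).

Let metricC x u v : metric x u v = metric x v u.
Proof.
rewrite /metric [u.1 * _ + _]addrC; congr (_ + _).
set X := ppart x u.2; set Y := ppart x v.2.
rewrite -{1}[Y](lker0_lfunVK (nu_ker x.1)) nu_sym.
by rewrite (lker0_lfunVK (nu_ker x.1)).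
Qed.

Let metricP x a u v w : metric x (a *: u + v) w = a * metric x u w + metric x v w.
Proof.
have -> : metric x (a *: u + v) w = (a * u.1 + v.1) * zpart x w.2
    + w.1 * (a * zpart x u.2 + zpart x v.2)
    + (a * omega0 Z0 (vsval ((nu x.1)^-1%VF (ppart x u.2))) (vsval (ppart x w.2))
      + omega0 Z0 (vsval ((nu x.1)^-1%VF (ppart x v.2))) (vsval (ppart x w.2))).
  rewrite /metric -zpartP -omega0Z -omega0D; congr (_ + omega0 _ _ _).
  by rewrite !linearP.
rewrite /metric; ring.
Qed.

Let metric_bilinear x : bilinear_for *%R *%R (metric x).
Proof.
split=> w a u v; first exact: metricP.
by rewrite ![metric x w _]metricC metricP.
Qed.

Let metric_herm x : {g : {symmetric (spacetime R n)} | forall u v, g u v = metric x u v}.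
Proof.
have S u v : metric x u v = (-1) ^+ false * idfun (metric x v u).
  by rewrite metricC mul1r.
have L1 w : zmod_morphism ((metric x) ^~ w).
  by move=> u v; rewrite addrC -scaleN1r metricP mulN1r addrC.
have L2 w : zmod_morphism (metric x w).
  by move=> u v; rewrite ![metric x w _]metricC L1.
have Z1 w : scalable_for *%R ((metric x) ^~ w).
  move=> a u; rewrite -[a *: u]addr0 metricP. 
  have := L1 w 0 0; rewrite subr0 subrr => ->; by rewrite addr0.
have Z2 w : scalable_for (idfun \; *%R) (metric x w).
  by move=> a u; rewrite ![metric x w _]metricC Z1.
pose b := @isBilinear.Build R (spacetime R n) (spacetime R n) R *%R (idfun \; *%R) (metric x) L1 L2 Z1 Z2.
pose c := @isHermitianSesquilinear.Build R (spacetime R n) false idfun (metric x) S.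
pose g : {symmetric (spacetime R n)} := HB.pack (metric x) b c.
by exists g.
Qed.

Let metric_frame x a b c e (X Y : subvs_of p) :
  metric x (a, frame x (vsval X + c *: Z0)) (b, frame x (vsval Y + e *: Z0)) =
  a * e + b * c + omega0 Z0 (vsval ((nu x.1)^-1%VF X)) (vsval Y).
Proof. by rewrite /metric /= !ppart_frame !zpart_frame ?subvsP. Qed.

Let frameZ0 x : frame x Z0 = frame x (vsval (0 : subvs_of p) + 1 *: Z0).
Proof. by rewrite linear0 add0r scale1r. Qed.

Let frame_p x (X : subvs_of p) :
  frame x (vsval X) = frame x (vsval X + 0 *: Z0).
Proof. by rewrite scale0r addr0. Qed.

Let frame_0 x : ddt = (1, frame x (vsval (0 : subvs_of p) + 0 *: Z0)).
Proof. by rewrite linear0 add0r scale0r linear0. Qed.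

Let omega0_0l Y : omega0 Z0 0 Y = 0.
Proof. by rewrite /omega0 heis_bracket0l mul0r. Qed.

Lemma associated_metric_exists : exists g, associated_metric p Z0 Phi g.
Proof.
exists (fun x => sval (metric_herm x)) => x.
case: (metric_herm x) => g gE /=.
have vp X : X \in p -> X = vsval (vsproj p X) by move=> Xp; rewrite vsprojK.
split.
- by rewrite gE (frame_0 x) metric_frame !linear0 omega0_0l !mulr0 !addr0.
- rewrite gE fund_frame frameZ0 (frame_0 x) metric_frame !linear0 omega0_0l.
  by rewrite mulr0 !addr0 mulr1.
- move=> X /vp ->; rewrite gE fund_frame frame_p (frame_0 x) metric_frame.
  by rewrite !linear0 omega0_0l !mulr0 !addr0.
- rewrite gE fund_frame frameZ0 metric_frame !linear0 omega0_0l.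
  by rewrite !mul0r !addr0.
split=> [X /vp ->|X Y]; rewrite gE !fund_frame ?frameZ0 !frame_p metric_frame.
  by rewrite !linear0 omega0_0l !mul0r !addr0.
by rewrite !mul0r !add0r.
Qed.

Let associated_metricE g x u v :
  associated_metric p Z0 Phi g -> g x u v = metric x u v.
Proof.
move=> /(_ x)[gWW gWZ gWX gZZ [gZX gXX]].
have D (w : spacetime R n) : exists a c (X : subvs_of p),
    w = a *: ddt + (c *: fund Phi x Z0 + fund Phi x (vsval X)) /\
    w = (a, frame x (vsval X + c *: Z0)).
  have [X [c E]] := decomp x w.2; exists w.1, c, X.
  rewrite [w]surjective_pairing E; split=> //=; rewrite !fund_frame.
  congr (_, _); first by rewrite /= scaler0 !addr0; exact/esym/mulr1.
  by rewrite /= scaler0 add0r linearD linearZ /= addrC.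
have [a [c [X [uL uE]]]] := D u; have [b [e [Y [vL vE]]]] := D v.
rewrite [in RHS]uE [in RHS]vE metric_frame uL vL.
have WX := gWX _ (subvsP X).
have WY := gWX _ (subvsP Y).
have ZX := gZX _ (subvsP X).
have ZY := gZX _ (subvsP Y).
have := null_frame_eval a b c e gWW gWZ gZZ WX WY ZX ZY.
by rewrite gXX.
Qed.

Lemma associated_metric_unique g1 g2 :
  associated_metric p Z0 Phi g1 -> associated_metric p Z0 Phi g2 ->
  forall x u v, g1 x u v = g2 x u v.
Proof.
by move=> g1P g2P x u v; rewrite (associated_metricE _ _ _ g1P) (associated_metricE _ _ _ g2P).
Qed.

Lemma associated_metric_lorentzian g x :
  associated_metric p Z0 Phi g -> lorentzian (g x).
Proof.
move=> gP; exists (1, frame x (vsval (0 : subvs_of p) + (- 2^-1) *: Z0)).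
  rewrite (associated_metricE _ _ _ gP) metric_frame !linear0 omega0_0l addr0.
  by lra.
move=> v; rewrite !(associated_metricE _ _ _ gP).
have [X [c E]] := decomp x v.2; rewrite [v]surjective_pairing E.
rewrite !metric_frame linear0 omega0_0l addr0 mul1r => vT v_neq0.
have -> : v.1 * c + v.1 * c = v.1 ^+ 2 by rewrite expr2; nra.
have [_ /(_ x.1)[_ _ _ dX]] := Phi_md.
set U := (nu x.1)^-1%VF X.
have XE : X = nu x.1 U by rewrite /U lker0_lfunVK.
have [U0|/dX U_gt0] := eqVneq U 0; last first.
  by rewrite XE ltr_wpDl ?sqr_ge0.
rewrite U0 linear0 omega0_0l addr0 exprn_even_gt0 //=.
apply: contra_neq v_neq0 => v0.
have c0 : c = 0 by nra.
by rewrite XE U0 v0 c0 !linear0 scale0r addr0 linear0.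
Qed.

End AssociatedMetric.

(* Main.v *)
Require Import Defs.
From mathcomp Require Import all_boot all_order all_algebra.
From mathcomp Require Import all_classical all_reals topology normedtype derive.
From HB Require Import structures.
From mathcomp Require Import ring sequences.

Set Implicit Arguments.
Unset Strict Implicit.
Unset Printing Implicit Defensive.

Import Order.TTheory GRing.Theory Num.Theory numFieldNormedType.Exports.
Local Open Scope classical_set_scope.
Local Open Scope ring_scope.

(** The action map x |-> h.x is an isometry because of three facts.

    An automorphism of H that is differentiable at the identity is linear in
    exponential coordinates ([double_diff_linear]), so that Phi_t = varphi_t.
    Hence d/ds Phi_s(h) at s = t is varphi_t (delta h), where delta is the
    logarithmic derivative of the path.

    This gives the differential of the action by h in the frame of the metric
    ([push_fund], [push_ddt]):
      f_x(Y) is sent to f_(h.x)(Ad_h Y), where Ad_h Y = Y - [h, Y], and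
      W is sent to W + f_(h.x)(delta h + [delta h, h] / 2).
    Write h = k Z0 + h_p with h_p in p. Since delta kills Z0 and preserves p, one
    has delta h = nu h_p in p, while both brackets are multiples of Z0. So W moves
    by a vector of f(p) and by multiples of f(Z0), and f(X) by a multiple of
    f(Z0) ([push_frame]).

    Finally the pairing omega0(nu^-1 X, nu h_p) is omega0(h_p, X), because delta
    is a derivation killing Z0 ([omega0_restrV]). The terms that appear
    in <W, f(X)> and <W, W> are then opposite in pairs: -omega0(h_p, X) against
    omega0(nu^-1 X, nu h_p), and omega0(nu h_p, h_p), coming from the two halves
    [delta h, h] / 2, against omega0(nu^-1 (nu h_p), nu h_p). *)

(** * Endomorphisms are linear in exponential coordinates *)

Section Doubling.
Context {R : realType} {V W : normedModType R}.

(** The quotients f(X / 2^k) / 2^-k are all f(X), and they converge to the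
    derivative of f at 0 along X. *)
Lemma double_diff_linear (f : V -> W) : differentiable f 0 ->
  (forall X, f (X *+ 2) = f X *+ 2) -> f = 'd f 0 :> (V -> W).
Proof.
move=> df f2; apply/funext => X.
have f0 : f 0 = 0.
  by move/eqP: (f2 0); rewrite mul0rn mulr2n -subr_eq0 opprD addNKr oppr_eq0 => /eqP.
have half k : (2^-1 ^+ k)^-1 *: f (2^-1 ^+ k *: X) = f X.
  elim: k => [|k IHk]; first by rewrite expr0 invr1 !scale1r.
  rewrite -[RHS]IHk exprS -scalerA; set Y := _ *: X.
  have {2}-> : Y = (2^-1 *: Y) *+ 2.
    by rewrite -scaler_nat scalerA divff ?scale1r // pnatr_eq0.
  by rewrite f2 invfM invrK mulr_natl -scalerMnl scalerMnr.
have to0 : (fun k => (2^-1 : R) ^+ k) @ \oo --> (0 : R)^'.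
  have lim0 : (fun k => (2^-1 : R) ^+ k) @ \oo --> (0 : R).
    apply: cvg_expr; rewrite gtr0_norm ?invr_gt0 // invf_lt1 //.
    by rewrite ltr1n.
  move=> A /lim0 A_half; apply: (@filterS nat \oo _ _ _ _ A_half) => k /=; apply.
  by apply: expf_neq0; rewrite invr_eq0 pnatr_eq0.
have /(cvg_comp _ _ to0) := @diff_derivable _ _ _ _ _ X df.
rewrite -/('D_X f 0) deriveE // => lim_quot.
rewrite -(cvg_lim (@norm_hausdorff _ _) lim_quot); apply/esym/lim_near_cst => //.
by apply: nearW => k /=; rewrite addr0 f0 subr0.
Qed.
End Doubling.

(** * The bracket as a differentiable map *)

Section Bracket.
Context {R : realType} {n : nat}.
Implicit Types X Y g : heis_alg R n.

Lemma continuous_heis_coord (i : 'I_n) :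
  continuous (fun X : heis_alg R n => X.1.1 0 i) /\
  continuous (fun X : heis_alg R n => X.1.2 0 i).
Proof.
split=> X.
- apply: (@continuous_comp _ _ _ (fun X : heis_alg R n => X.1.1)
    (fun A : 'rV_n => A 0 i)); last exact: coord_continuous.
  by apply: (@continuous_comp (heis_alg R n) ('rV[R]_n * 'rV[R]_n)%type _ fst fst);
    exact: cvg_fst.
- apply: (@continuous_comp _ _ _ (fun X : heis_alg R n => X.1.2)
    (fun A : 'rV_n => A 0 i)); last exact: coord_continuous.
  by apply: (@continuous_comp (heis_alg R n) ('rV[R]_n * 'rV[R]_n)%type _ fst snd);
    [exact: cvg_fst|exact: cvg_snd].
Qed.

Lemma heis_bracket_is_bilinear :
  bilinear_for *:%R *:%R (@heis_bracket R n).
Proof.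
split=> Y a X X' /=; first by rewrite heis_bracketDl heis_bracketZl.
by rewrite heis_bracketDr heis_bracketZr.
Qed.

Lemma continuous_heis_bracket :
  continuous (fun q : heis_alg R n * heis_alg R n => heis_bracket q.1 q.2).
Proof.
move=> q.
pose s (q : heis_alg R n * heis_alg R n) :=
  \sum_(i < n) (q.1.1.1 0 i * q.2.1.2 0 i - q.1.1.2 0 i * q.2.1.1 0 i).
have -> : (fun q => heis_bracket q.1 q.2) = fun q => s q *: (0, 0, 1).
  apply/funext => q'; rewrite /heis_bracket.
  by congr (_, _, _); rewrite /= ?scaler0 // -[_ *: _]/(_ * _) mulr1.
apply: cvgZr_tmp; apply: (@cvg_big _ _ +%R) => [|i _]; first exact: add_continuous.
have [c1 c2] := continuous_heis_coord i.
have c f : continuous f -> {for q, continuous (f \o fst)} /\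
    {for q, continuous (f \o snd : heis_alg R n * heis_alg R n -> R)}.
  by move=> cf; split; apply: continuous_comp (cf _); [exact: cvg_fst|exact: cvg_snd].
have [c11 c12] := c _ c1; have [c21 c22] := c _ c2.
by apply: cvgB; apply: cvgM; [exact: c11|exact: c22|exact: c21|exact: c12].
Qed.

Lemma is_diff_heis_bracket (q : heis_alg R n * heis_alg R n) :
  is_diff q (fun q => heis_bracket q.1 q.2)
    (fun u => heis_bracket q.1 u.2 + heis_bracket u.1 q.2).
Proof.
pose b := bilinear_isBilinear.Build R _ _ _ _ _ (@heis_bracket R n)
  heis_bracket_is_bilinear.
pose B : {bilinear heis_alg R n -> heis_alg R n -> heis_alg R n} :=
  HB.pack (@heis_bracket R n) b.
have cB := continuous_heis_bracket : continuous (fun q => B q.1 q.2).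
by apply: DiffDef; [exact: (differentiable_bilin _ cB)|exact: (diff_bilin _ cB)].
Qed.

Lemma heis_dmulrK g X : heis_dmulr g (X + 2^-1 *: heis_bracket X g) = X.
Proof.
rewrite /heis_dmulr heis_bracketDl heis_bracketZl heis_bracket_bracketl.
by rewrite scaler0 addr0 addrK.
Qed.

(** The chain rule for right translation by h followed by right translation
    by g. *)
Lemma heis_dmulrM g h X :
  heis_dmulr (heis_mul h g) X = heis_dmulr g (heis_dmulr h X).
Proof.
rewrite /heis_dmulr /heis_mul !(heis_bracketDl, heis_bracketDr).
rewrite -!scaleNr !(heis_bracketZl, heis_bracketZr).
rewrite heis_bracket_bracketl heis_bracket_bracketr !scaler0 !addr0 scalerDr.
by rewrite addrA.
Qed.

End Bracket.

(** Squaring in H is doubling in exponential coordinates, so endomorphisms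
    commute with doubling. *)
Lemma heis_endo_linear (R : realType) (n : nat) (f : heis R n -> heis R n) :
  differentiable f (0 : heis R n) -> {morph f : g h / heis_mul g h} ->
  f = 'd f (0 : heis R n) :> (heis R n -> heis R n).
Proof.
move=> df fM; apply: double_diff_linear df _ => X.
have mulXX (Y : heis R n) : Y *+ 2 = heis_mul Y Y.
  by rewrite /heis_mul heis_bracketXX scaler0 subr0.
by rewrite !mulXX fM.
Qed.

Lemma heis_endo_bracket (R : realType) (n : nat) (f : 'End(heis_alg R n)) :
  {morph f : g h / heis_mul g h} -> {morph f : X Y / heis_bracket X Y}.
Proof.
move=> fM X Y; have := fM X Y; rewrite /heis_mul !linearB linearD linearZ /=.
move=> /addrI/oppr_inj; apply: scalerI.
by rewrite invr_eq0 pnatr_eq0.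
Qed.

(** * The differential of the twisted action *)

Section AutomorphismPath.
Context {R : realType} {n : nat} (Phi : R -> heis R n -> heis R n).
Hypothesis Phi_path : aut_path Phi.
Implicit Types (x u : spacetime R n) (h X Y : heis_alg R n).

Lemma path_diffE t X : path_diff Phi t X = Phi t X.
Proof.
have [/(_ t)[dPhi PhiM _] _] := Phi_path.
by rewrite lfunE -(heis_endo_linear (dPhi [::] 0) PhiM).
Qed.

Lemma path_diffM t : {morph path_diff Phi t : g h / heis_mul g h}.
Proof. by have [/(_ t)[_ PhiM _] _] := Phi_path => g h; rewrite !path_diffE. Qed.

Lemma path_diff_surj t X : exists Y, path_diff Phi t Y = X.
Proof.
have [/(_ t)[_ _ [f' [_ _ f'K]]] _] := Phi_path.
by exists (f' X); rewrite path_diffE f'K.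
Qed.

Lemma path_diff_ker t : lker (path_diff Phi t) == 0%VS.
Proof.
have [/(_ t)[_ _ [f' [_ fK _]]] _] := Phi_path.
by apply/lker0P; apply: (@can_inj _ _ _ f') => X; rewrite path_diffE fK.
Qed.

Lemma path_diff_smooth t X : differentiable (fun s => path_diff Phi s X) t.
Proof.
have -> : (fun s => path_diff Phi s X) =
    (fun x : spacetime R n => Phi x.1 x.2) \o (fun s => (s, X)).
  by apply/funext => s; rewrite path_diffE.
have [_ /(_ [::] (t, X)) /= dPhi] := Phi_path.
by apply: differentiable_comp => //;
  have [] := @is_diff_pair R R R _ id id (cst X) 0 t _ _.
Qed.

Lemma path_diff'E t X :
  path_diff' Phi t X = derive1 (fun s => path_diff Phi s X) t.
Proof.
pose f X s := path_diff Phi s X; pose D X := derive1 (f X) t.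
have df Y : derivable (f Y) t 1 by apply/derivable1_diffP; exact: path_diff_smooth.
have D_lin : linear D.
  move=> a Y Z; rewrite /D !derive1E.
  have -> : f (a *: Y + Z) = a \*: f Y + f Z.
    apply/funext => s; rewrite [RHS]/(a *: path_diff Phi s Y + path_diff Phi s Z).
    exact: linearP.
  by rewrite (deriveD (derivableZ (df Y)) (df Z)) (deriveZ _ (df Y)).
pose DL := GRing.isLinear.Build R _ _ _ D D_lin.
pose L : {linear heis_alg R n -> heis_alg R n} := HB.pack D DL.
exact: (lfunE L).
Qed.

Lemma path_diff_log_deriv t X :
  path_diff Phi t (log_deriv Phi t X) = path_diff' Phi t X.
Proof. by rewrite /log_deriv comp_lfunE lker0_lfunVK // path_diff_ker. Qed.

Lemma fundE x Y : fund Phi x Y = (0, heis_dmulr x.2 (path_diff Phi x.1 Y)).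
Proof.
set V := heis_dmulr _ _.
have -> : fund Phi x Y = derive1 (fun r : R => (x.1, r *: V + x.2)) 0.
  congr (derive1 _ 0); apply/funext => r.
  rewrite /twisted_act /heis_exp -path_diffE /V -!linearZ /=.
  by rewrite /heis_mul /heis_dmulr addrAC.
have dV : is_diff (0 : R) ( *:%R ^~ V + cst x.2) ( *:%R ^~ V + 0) by exact: is_diffD.
have [dl dlE] : is_diff (0 : R) (fun r : R => (x.1, r *: V + x.2))
    (fun r => (0, r *: V + 0)).
  exact: (is_diff_pair (is_diff_cst x.1 0) dV).
by rewrite derive1E deriveE // dlE scale1r addr0.
Qed.

Lemma fund_linear x : linear (fund Phi x).
Proof.
move=> a X Y; rewrite fundE fundE fundE (linearP (path_diff Phi x.1)).
rewrite heis_dmulr_is_linear.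
congr (_, _).
by rewrite /= scaler0 addr0.
Qed.

Lemma fund_surj x v : exists Y, (0, v) = fund Phi x Y.
Proof.
have [Y YE] := path_diff_surj x.1 (v + 2^-1 *: heis_bracket v x.2).
by exists Y; rewrite fundE YE heis_dmulrK.
Qed.

Lemma is_diff_twisted_act h x :
  is_diff x (twisted_act Phi h) (fun u =>
    (u.1, u.1 *: heis_dmulr x.2 (path_diff' Phi x.1 h) +
          (u.2 - 2^-1 *: heis_bracket (path_diff Phi x.1 h) u.2))).
Proof.
pose P (y : spacetime R n) := path_diff Phi y.1 h.
pose dP (u : spacetime R n) := u.1 *: path_diff' Phi x.1 h.
have d1 : is_diff x (fst : spacetime R n -> R) fst.
  by apply: DiffDef; [apply: linear_differentiable|apply: diff_lin] => y; exact: cvg_fst.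
have d2 : is_diff x (snd : spacetime R n -> heis R n) snd.
  by apply: DiffDef; [apply: linear_differentiable|apply: diff_lin] => y; exact: cvg_snd.
have dPx : is_diff x P dP.
  have dh : is_diff (x.1) (fun s => path_diff Phi s h)
      (fun r => r *: path_diff' Phi x.1 h).
    apply: DiffDef; first exact: path_diff_smooth.
    by rewrite diff1E ?path_diff'E //; exact: path_diff_smooth.
  exact: (is_diff_comp d1 dh).
have dB : is_diff x (fun y => heis_bracket (P y) y.2)
    (fun u => heis_bracket (P x) u.2 + heis_bracket (dP u) x.2).
  have dpair : is_diff x (fun y => (P y, y.2)) (fun u => (dP u, u.2)).
    exact: is_diff_pair.
  have dbr := is_diff_heis_bracket (P x, x.2).
  exact: (is_diff_comp dpair dbr).
have dF : is_diff x
    (fun y : spacetime R n => (y.1, P y + y.2 - 2^-1 *: heis_bracket (P y) y.2))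
    (fun u => (u.1, dP u + u.2 - 2^-1 *:
        (heis_bracket (P x) u.2 + heis_bracket (dP u) x.2))).
  apply: is_diff_pair; apply: is_diffB; apply: is_diffZ.
have -> : twisted_act Phi h =
    fun y => (y.1, P y + y.2 - 2^-1 *: heis_bracket (P y) y.2).
  by apply/funext => y; rewrite /P path_diffE.
apply: is_diff_eq dF _; apply/funext => u; congr (_, _).
rewrite heis_bracketZl scalerDr opprD [in LHS](addrC (- _)) addrACA.
by congr (_ + _); rewrite /heis_dmulr scalerBr scalerA mulrC -scalerA.
Qed.

(** h e^(rY) = e^(r Ad_h Y) h, and Ad_h Y = Y - [h, Y] for the bracket of
    right-invariant fields. *)
Lemma push_fund h x Y :
  'd (twisted_act Phi h) x (fund Phi x Y) =
  fund Phi (twisted_act Phi h x) (Y - heis_bracket h Y).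
Proof.
have [_ ->] := is_diff_twisted_act h x.
rewrite fundE fundE; congr (_, _); rewrite /= scale0r add0r.
rewrite -path_diffE heis_dmulrM.
rewrite (linearB (path_diff Phi x.1)) /=.
rewrite (heis_endo_bracket (path_diffM _)).
set U := path_diff _ _ Y; set G := path_diff _ _ h.
have -> : heis_dmulr G (U - heis_bracket G U) = U - 2^-1 *: heis_bracket G U.
  rewrite /heis_dmulr heis_bracketDl heis_bracketNl heis_bracket_bracketl.
  rewrite oppr0 addr0 [heis_bracket U G]heis_bracketC scalerN opprK -addrA.
  congr (_ + _); rewrite -{1}[heis_bracket G U]scale1r -scaleNr -scalerDl -scaleNr.
  by congr (_ *: _); field.
rewrite /heis_dmulr -!scaleNr heis_bracketDl heis_bracketDr heis_bracketZl.
rewrite heis_bracketZr heis_bracket_bracketl heis_bracket_bracketr !scaler0.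
by rewrite !addr0 addrAC.
Qed.

(** The curve s |-> Phi_s(h) has velocity varphi_t (delta h) at Phi_t(h); it is
    expressed by f_(h.x) after undoing the differential of right translation by
    Phi_t(h), whence the term [delta h, h] / 2. *)
Lemma push_ddt h x (d := log_deriv Phi x.1 h) :
  'd (twisted_act Phi h) x ddt =
  ddt + fund Phi (twisted_act Phi h x) (d + 2^-1 *: heis_bracket d h).
Proof.
have [_ ->] := is_diff_twisted_act h x.
rewrite fundE /ddt /= -path_diffE heis_dmulrM.
rewrite (linearD (path_diff Phi x.1)) (linearZ_LR (path_diff Phi x.1)) /=.
rewrite (heis_endo_bracket (path_diffM _)).
rewrite heis_dmulrK path_diff_log_deriv scale1r.
rewrite heis_bracketC heis_bracket0l oppr0 scaler0 subr0 addr0.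
by congr (_, _); rewrite /= ?addr0 ?add0r.
Qed.

End AutomorphismPath.

(** * The symplectic form and definite derivations *)

Section Omega.
Context {R : realType} {n : nat} (Z0 : heis_alg R n).
Implicit Types X Y : heis_alg R n.

Lemma omega0C X Y : omega0 Z0 X Y = - omega0 Z0 Y X.
Proof. by rewrite /omega0 heis_bracketC mulNr. Qed.

Lemma omega0D X X' Y : omega0 Z0 (X + X') Y = omega0 Z0 X Y + omega0 Z0 X' Y.
Proof. by rewrite /omega0 heis_bracketDl mulrDl. Qed.

Lemma omega0Z a X Y : omega0 Z0 (a *: X) Y = a * omega0 Z0 X Y.
Proof. by rewrite /omega0 heis_bracketZl mulrA. Qed.

Lemma omega0Dr X Y Y' : omega0 Z0 X (Y + Y') = omega0 Z0 X Y + omega0 Z0 X Y'.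
Proof. by rewrite /omega0 heis_bracketDr mulrDl. Qed.

Lemma omega0Zr a X Y : omega0 Z0 X (a *: Y) = a * omega0 Z0 X Y.
Proof. by rewrite /omega0 heis_bracketZr mulrA. Qed.

Lemma omega0_central X : central Z0 -> omega0 Z0 Z0 X = 0.
Proof. by rewrite /omega0 => ->; rewrite mul0r. Qed.

End Omega.

Section DefiniteDerivation.
Context {R : realType} {n : nat} (p : {vspace heis_alg R n}) (Z0 : heis_alg R n).
Context (d : 'End(heis_alg R n)).
Hypothesis d_def : definite_derivation p Z0 d.

Lemma restrE (X : subvs_of p) : vsval (restr p d X) = d (vsval X).
Proof.
have [_ dp _ _] := d_def.
rewrite /restr (lfunE (vsproj p \o (d \o vsval))) /= vsprojK //.
by apply: (subvP dp); exact/memv_img/subvsP.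
Qed.

(** A definite form vanishes on no nonzero vector, hence definiteness forces
    injectivity. *)
Lemma restr_ker : lker (restr p d) == 0%VS.
Proof.
have [_ _ _ d_pos] := d_def.
rewrite -subv0; apply/subvP => Y; rewrite memv_ker memv0 => /eqP dY.
apply: contraT => /d_pos; rewrite dY linear0.
by rewrite omega0C /omega0 heis_bracket0l mul0r oppr0 ltxx.
Qed.

Lemma restrK (X : subvs_of p) : ((restr p d)^-1)%VF (restr p d X) = X.
Proof. exact: lker0_lfunK restr_ker _. Qed.

(** Applying the derivation to [X, Y] = omega0 X Y Z0 gives zero, since it kills
    Z0; the Leibniz rule then says that the derivation is skew-adjoint for
    omega0. *)
Lemma restr_sym (X Y : subvs_of p) : Z0 != 0 -> central Z0 ->
  omega0 Z0 (vsval X) (vsval (restr p d Y)) =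
  omega0 Z0 (vsval Y) (vsval (restr p d X)).
Proof.
move=> Z0_neq0 Z0_central; have [dM _ dZ0 _] := d_def.
have := dM (vsval X) (vsval Y).
rewrite !(omega0P Z0_neq0 Z0_central) linearZ /= dZ0 scaler0.
rewrite -scalerDl => /esym/eqP; rewrite scaler_eq0 (negPf Z0_neq0) orbF.
by rewrite -!restrE [omega0 _ _ (vsval Y)]omega0C addrC subr_eq0 => /eqP.
Qed.

Lemma omega0_restrV (X Y : subvs_of p) : Z0 != 0 -> central Z0 ->
  omega0 Z0 (vsval (((restr p d)^-1)%VF X)) (vsval (restr p d Y)) =
  omega0 Z0 (vsval Y) (vsval X).
Proof.
by move=> Z0_neq0 Z0_central; rewrite restr_sym // lker0_lfunVK // restr_ker.
Qed.

End DefiniteDerivation.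

(** * The metric in the moving frame *)

Section Invariance.
Context {R : realType} {n : nat} (p : {vspace heis_alg R n}) (Z0 : heis_alg R n).
Hypotheses (Z0_neq0 : Z0 != 0) (Z0_central : central Z0).
Hypothesis p_add_Z0 : (p + <[Z0]>)%VS = fullv.
Context (Phi : R -> heis R n -> heis R n).
Hypothesis Phi_md : metric_defining p Z0 Phi.

Let Phi_path : aut_path Phi. Proof. by case: Phi_md. Qed.

Let fundD x X Y : fund Phi x (X + Y) = fund Phi x X + fund Phi x Y.
Proof. by have := fund_linear Phi_path x 1 X Y; rewrite !scale1r. Qed.

Let fundZ x a X : fund Phi x (a *: X) = a *: fund Phi x X.
Proof.
have f0 : fund Phi x 0 = 0.
  by apply: (addrI (fund Phi x 0)); rewrite -fundD !addr0.
by have := fund_linear Phi_path x a X 0; rewrite f0 !addr0.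
Qed.

Lemma splitting_decomp (v : heis_alg R n) :
  exists c (X : subvs_of p), v = c *: Z0 + vsval X.
Proof.
have : v \in (p + <[Z0]>)%VS by rewrite p_add_Z0 memvf.
case/memv_addP => X Xp [_ /vlineP[c ->] ->].
by exists c, (vsproj p X); rewrite vsprojK // addrC.
Qed.

Lemma spacetime_decomp (x v : spacetime R n) : exists a c (X : subvs_of p),
  v = a *: ddt + fund Phi x (c *: Z0 + vsval X).
Proof.
have [Y YE] := fund_surj Phi_path x v.2; have [c [X XE]] := splitting_decomp Y.
exists v.1, c, X; rewrite -XE -YE [LHS]surjective_pairing.
by congr (_, _); rewrite /= ?scaler0 ?add0r // addr0; exact/esym/mulr1.
Qed.

Lemma associated_metric_eval g x a b c e (X Y : subvs_of p) :
  associated_metric p Z0 Phi g ->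
  g x (a *: ddt + fund Phi x (c *: Z0 + vsval X))
      (b *: ddt + fund Phi x (e *: Z0 + vsval Y)) =
  a * e + b * c +
  omega0 Z0 (vsval (((restr p (log_deriv Phi x.1))^-1)%VF X)) (vsval Y).
Proof.
move=> /(_ x)[gWW gWZ gWX gZZ [gZX gXX]]; rewrite -gXX !fundD !fundZ.
exact: (null_frame_eval a b c e gWW gWZ gZZ (gWX _ (subvsP X))
  (gWX _ (subvsP Y)) (gZX _ (subvsP X)) (gZX _ (subvsP Y))).
Qed.

(** In the frame W, f(Z0), f(p) the action is a unipotent map: all brackets with
    h land in the line of Z0, and delta h = nu h_p lies in p. *)
Lemma push_frame h x a c (hp X : subvs_of p) k
    (S := restr p (log_deriv Phi x.1) hp) :
  h = k *: Z0 + vsval hp ->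
  'd (twisted_act Phi h) x (a *: ddt + fund Phi x (c *: Z0 + vsval X)) =
  a *: ddt + fund Phi (twisted_act Phi h x)
    ((c + a * (2^-1 * omega0 Z0 (vsval S) (vsval hp)) -
        omega0 Z0 (vsval hp) (vsval X)) *: Z0 + vsval (X + a *: S)).
Proof.
move=> hE; have [_ /(_ x.1) d_def] := Phi_md; have [_ _ dZ0 _] := d_def.
have dh : log_deriv Phi x.1 h = vsval S.
  by rewrite /S (restrE d_def) hE linearD linearZ /= dZ0 scaler0 add0r.
have omega_h Y : omega0 Z0 h Y = omega0 Z0 (vsval hp) Y.
  by rewrite hE omega0D omega0Z omega0_central // mulr0 add0r.
transitivity (a *: 'd (twisted_act Phi h) x ddt +
    'd (twisted_act Phi h) x (fund Phi x (c *: Z0 + vsval X))).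
  exact: (linearP ('d (twisted_act Phi h) x)).
rewrite (push_ddt Phi_path) (push_fund Phi_path) dh.
rewrite !(omega0P Z0_neq0 Z0_central) scalerDr -addrA -fundZ -fundD.
congr (_ + fund _ _ _).
rewrite omega_h [omega0 _ _ h]omega0C omega_h.
rewrite omega0Dr omega0Zr [omega0 _ (vsval hp) Z0]omega0C omega0_central //.
rewrite -omega0C oppr0 mulr0 add0r scalerDr !scalerA.
have -> : vsval (X + a *: S) = vsval X + a *: vsval S by rewrite linearD linearZ.
rewrite scalerBl scalerDl [LHS](AC (2*3) ((3*2*5)*(4*1))).
by rewrite [a * (_ * _)]mulrA.
Qed.

End Invariance.

Theorem proposition3p3 (R : realType) (n : nat) (n_gt0 : (0 < n)%N)
    (p : {vspace heis_alg R n}) (Z0 : heis_alg R n)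
    (Z0_neq0 : Z0 != 0) (Z0_central : central Z0)
    (p_add_Z0 : (p + <[Z0]>)%VS = fullv) (p_cap_Z0 : (p :&: <[Z0]>)%VS = 0%VS)
    (Phi : R -> heis R n -> heis R n) (Phi_md : metric_defining p Z0 Phi)
    (g : spacetime R n -> {symmetric (spacetime R n)})
    (g_assoc : associated_metric p Z0 Phi g) :
  H_invariant Phi g.
Proof.
move=> h x u v.
have [a [c [X ->]]] := spacetime_decomp p_add_Z0 Phi_md x u.
have [b [e [Y ->]]] := spacetime_decomp p_add_Z0 Phi_md x v.
have [k [hp hE]] := splitting_decomp p_add_Z0 h.
have uE := push_frame Z0_neq0 Z0_central Phi_md x a c X hE.
have vE := push_frame Z0_neq0 Z0_central Phi_md x b e Y hE.
(* The hypotheses on g pin down both sides on the frame: what remains is a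
   polynomial identity in the coefficients and in omega0. *)
apply: etrans (congr2 (fun u v => g (twisted_act Phi h x) u v) uE vE) _.
have eval := associated_metric_eval Phi_md _ _ _ _ _ _ _ g_assoc.
apply: etrans (eval _ _ _ _ _ _ _) (etrans _ (esym (eval _ _ _ _ _ _ _))).
have [_ /(_ x.1) d_def] := Phi_md.
have -> : (twisted_act Phi h x).1 = x.1 by [].
clear uE vE eval.
set nu := restr p _; set S := nu hp.
have valD r (U V : subvs_of p) : vsval (U + r *: V) = vsval U + r *: vsval V.
  by rewrite linearD linearZ.
have nuVD : (nu^-1)%VF (X + a *: S) = (nu^-1)%VF X + a *: hp.
  by rewrite linearD linearZ /= (restrK d_def).
rewrite nuVD !valD !omega0D !omega0Z !omega0Dr !omega0Zr.
rewrite (omega0_restrV d_def) // [omega0 _ (vsval S) _]omega0C.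
by field.
Qed.
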